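(* Let $C,D$ be two nonempty closed subsets of $\mathbb{R}^n$ and let $$L_{C,D}(x,y)=\delta_C(x)+\tfrac12\|x-y\|^2+\delta_D(y),\qquad (x,y)\in\mathbb{R}^n\times\mathbb{R}^n.$$ Let $0<r_-<r_+$ and let $\lambda_k,\mu_k\in(r_-,r_+)$ for all $k\ge0$. For $x_0\in\mathbb{R}^n$ and $y_0\in D$ consider sequences $(x_k,y_k)_{k\ge 0}$ starting from $(x_0,y_0)$ and generated by the alternating projection algorithm $$x_{k+1}\in P_C\left(\frac{\lambda_k^{-1}x_k+y_k}{\lambda_k^{-1}+1}\right),\qquad y_{k+1}\in P_D\left(\frac{\mu_k^{-1}y_k+x_{k+1}}{\mu_k^{-1}+1}\right),\qquad k\ge 0.$$ (Convergence of sequences) Assume that $L_{C,D}$ has the Kurdyka-Łojasiewicz property at each point of $\operatorname{dom}\partial L_{C,D}$. Then either $\|(x_k,y_k)\|\to\infty$ as $k\to\infty$, or $(x_k,y_k)$ converges to a critical point of $L_{C,D}$. (Local convergence) Assume that $L_{C,D}$ has the Kurdyka-Łojasiewicz property at $(x^*,y^* )\in C\times D$ and that $\|x^*-y^*\|=\min\{\|x-y\|:x\in C,\ y\in D\}$. If $(x_0,y_0)$ is sufficiently close to $(x^*,y^* )$, then the whole sequence $(x_k,y_k)$ converges to a point $(x_\infty,y_\infty)$ such that $\|x_\infty-y_\infty\|=\min\{\|x-y\|:x\in C,\ y\in D\}$.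
   Context: $\|\cdot\|$ is the Euclidean norm. $\delta_C$ is the indicator function of $C$: $\delta_C(x)=0$ if $x\in C$ and $+\infty$ otherwise. $P_C$ is the point-to-set projection $P_C(x)=\operatorname{argmin}\{\|x-z\|:z\in C\}$ (nonempty for $C$ nonempty closed). For a proper lower semicontinuous $h:\mathbb{R}^N\to\mathbb{R}\cup\{+\infty\}$, $\operatorname{dom}h=\{x:h(x)<+\infty\}$. For $x\in\operatorname{dom}h$ the Fréchet subdifferential $\hat\partial h(x)$ is the set of $x^*$ with $\liminf_{y\to x,\,y\ne x}\frac{1}{\|x-y\|}[h(y)-h(x)-\langle x^*,y-x\rangle]\ge 0$. The (limiting) subdifferential of $h$ at $x\in\operatorname{dom}h$ is $\partial h(x)=\{x^*:\exists\,x_j\to x,\ h(x_j)\to h(x),\ x_j^*\in\hat\partial h(x_j),\ x_j^*\to x^*\}$, and both are empty for $x\notin\operatorname{dom}h$; $\operatorname{dom}\partial h=\{x:\partial h(x)\neq\emptyset\}$. A critical point of $h$ is a point $x$ with $0\in\partial h(x)$. $\operatorname{dist}(x,K)=\inf\{\|x-z\|:z\in K\}$, equal to $+\infty$ if $K=\emptyset$. The function $h$ has the Kurdyka-Łojasiewicz property at $\bar x\in\operatorname{dom}\partial h$ if there exist $\eta\in(0,+\infty]$, a neighborhood $U$ of $\bar x$ and a continuous concave function $\varphi:[0,\eta)\to\mathbb{R}_+$ such that $\varphi(0)=0$, $\varphi$ is $C^1$ on $(0,\eta)$, $\varphi'(s)>0$ for all $s\in(0,\eta)$, and for all $x\in U$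 with $h(\bar x)<h(x)<h(\bar x)+\eta$ one has $\varphi'(h(x)-h(\bar x))\,\operatorname{dist}(0,\partial h(x))\ge 1$. *)

(* Defs.v *)
From HB Require Import structures.
From mathcomp Require Import all_boot all_order all_algebra.
From mathcomp Require Import all_classical all_reals all_analysis.

Set Implicit Arguments.
Unset Strict Implicit.
Unset Printing Implicit Defensive.

Import Order.TTheory GRing.Theory Num.Theory.
Import numFieldNormedType.Exports.

Local Open Scope classical_set_scope.
Local Open Scope ring_scope.

(* R^N is 'rV[R]_N. The norm `|_| that the library puts on row vectors is the
   sup norm, so the Euclidean norm is a separate function; both induce the
   same topology, hence [nbhs], [closed] and [-->] are the library's.
   R^n x R^n is 'rV[R]_(n + n), the pair (x, y) being [row_mx x y]; the
   Euclidean norm of [row_mx x y] is that of the product. *)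

Definition dotv (R : realType) (N : nat) (x y : 'rV[R]_N) : R :=
  \sum_(i < N) x ord0 i * y ord0 i.

Definition enorm (R : realType) (N : nat) (x : 'rV[R]_N) : R :=
  Num.sqrt (dotv x x).

Definition indic_fun (R : realType) (N : nat) (C : set 'rV[R]_N)
    (x : 'rV[R]_N) : \bar R :=
  if x \in C then 0%E else +oo%E.

Definition proj (R : realType) (N : nat) (C : set 'rV[R]_N) (x : 'rV[R]_N) :
    set 'rV[R]_N :=
  [set z | C z /\ forall w, C w -> enorm (x - z) <= enorm (x - w)].

Definition is_min (R : realType) (A : set R) (m : R) : Prop :=
  A m /\ lbound A m.

Definition edom (R : realType) (N : nat) (h : 'rV[R]_N -> \bar R) :
    set 'rV[R]_N :=
  [set x | (h x < +oo)%E].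

(* The functions h below are meant to be proper and lower semicontinuous; in
   particular they never take the value -oo. *)

Definition frechet_subdiff (R : realType) (N : nat) (h : 'rV[R]_N -> \bar R)
    (x : 'rV[R]_N) : set 'rV[R]_N :=
  [set xs | edom h x /\
    (0 <= limf_einf (fun y : 'rV[R]_N =>
            ((enorm (x - y))^-1)%:E * (h y - h x - (dotv xs (y - x))%:E))
          x^')%E].

Definition subdiff (R : realType) (N : nat) (h : 'rV[R]_N -> \bar R)
    (x : 'rV[R]_N) : set 'rV[R]_N :=
  [set xs | edom h x /\
    exists (u us : nat -> 'rV[R]_N),
      [/\ u @ \oo --> x,
          h (u j) @[j --> \oo] --> h x,
          forall j, frechet_subdiff h (u j) (us j)
        & us @ \oo --> xs]].

Definition dom_subdiff (R : realType) (N : nat) (h : 'rV[R]_N -> \bar R) :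
    set 'rV[R]_N :=
  [set x | subdiff h x !=set0].

Definition critical_point (R : realType) (N : nat) (h : 'rV[R]_N -> \bar R)
    (x : 'rV[R]_N) : Prop :=
  subdiff h x 0.

Definition edist (R : realType) (N : nat) (x : 'rV[R]_N)
    (K : set 'rV[R]_N) : \bar R :=
  ereal_inf [set (enorm (x - z))%:E | z in K].

(* The functions phi : [0, eta) -> R_+ with eta in (0, +oo]; they are total
   functions on R of which only the restriction to [0, eta) matters, the
   derivative being taken at interior points only. *)
Definition desingularizing (R : realType) (eta : \bar R) (phi : R -> R) :
    Prop :=
  let I := [set s : R^o | 0 <= s /\ (s%:E < eta)%E] in
  [/\ forall s, I s -> 0 <= phi s,
      {within I, continuous phi},
      convex_function I (fun s => - phi s),
      phi 0 = 0
    & forall s : R, 0 < s -> (s%:E < eta)%E ->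
        [/\ derivable phi s 1,
            {for s, continuous (derive1 phi)}
          & 0 < derive1 phi s]].

Definition KL_property (R : realType) (N : nat) (h : 'rV[R]_N -> \bar R)
    (xbar : 'rV[R]_N) : Prop :=
  dom_subdiff h xbar /\
  exists (eta : \bar R) (U : set 'rV[R]_N) (phi : R -> R),
    [/\ (0 < eta)%E, nbhs xbar U, desingularizing eta phi
      & forall x, U x -> (h xbar < h x)%E -> (h x < h xbar + eta)%E ->
          (1 <= (derive1 phi (fine (h x - h xbar)))%:E
                * edist 0 (subdiff h x))%E].

Definition LCD (R : realType) (n : nat) (C D : set 'rV[R]_n)
    (z : 'rV[R]_(n + n)) : \bar R :=
  let x := lsubmx z in
  let y := rsubmx z in
  (indic_fun C x + (2^-1 * enorm (x - y) ^+ 2)%:E + indic_fun D y)%E.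

Definition alternating_projection (R : realType) (n : nat)
    (C D : set 'rV[R]_n) (lam mu : nat -> R) (x y : nat -> 'rV[R]_n) : Prop :=
  forall k,
    proj C (((lam k)^-1 + 1)^-1 *: ((lam k)^-1 *: x k + y k)) (x k.+1) /\
    proj D (((mu k)^-1 + 1)^-1 *: ((mu k)^-1 *: y k + x k.+1)) (y k.+1).

(* Main.v *)
Require Import Defs.
From HB Require Import structures.
From mathcomp Require Import all_boot all_order all_algebra.
From mathcomp Require Import all_classical all_reals all_analysis.
From mathcomp Require Import ring lra.

Import Order.TTheory GRing.Theory Num.Theory.
Import numFieldNormedType.Exports.

Local Open Scope classical_set_scope.
Local Open Scope ring_scope.

(** Up to a constant factor and an additive constant, projecting the weighted
    mean of [x] and [y] on [C] is minimizing over [u] in [C] the quantity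
    [|u - y|^2 + l |u - x|^2], so the algorithm is a proximal alternating
    minimization of the function [L = LCD C D].  Write [z_k = (x_k, y_k)].
    Comparing the minimizer with another competitor gives two estimates:

    - sufficient decrease, [L z_(k+2) + a |z_(k+2) - z_(k+1)|^2 <= L z_(k+1)]
      (lemma [alternating_projection_decrease]); it starts at index 1, because
      [x_0] need not belong to [C];
    - a subgradient of [L] at [z_(k+1)] of norm at most [b |z_(k+1) - z_k|]
      (lemmas [step_subgradientP] and [step_subgradient_le]).

    Theorem [KL_descent_capture] draws from these two estimates and the
    Kurdyka-Lojasiewicz inequality at a point [zb] that a sequence which starts
    close enough to [zb], with a first step and an excess of [L] over [L zb]
    small enough, has finite length and [L z_k] tends to [L zb], provided that
    [L z_k] never falls below [L zb].  With
    [d_k = |z_(k+1) - z_k|] and [f_k = (b / a) phi (L z_(k+1) - L zb)], the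
    decrease, the inequality and the concavity of [phi] give
    [d_(k+1)^2 <= d_k (f_k - f_(k+1))], hence
    [2 d_(k+1) <= d_k + f_k - f_(k+1)].  So
    [|z_(k+1) - zb| + d_k + f_k] cannot increase while the sequence is in the
    ball where the inequality holds: it never leaves the ball, and
    [d_k + f_k] pays for the lengths of all later steps.

    Global convergence: if the norms do not tend to infinity, the sequence has
    a cluster point [zb].  The steps tend to 0, hence so do the subgradients,
    and [zb] is critical because [L] is continuous on [C x D]
    ([subdiff0_closed]).  The sequence comes close to [zb] with small steps and
    with [L z_k] close to [L zb], so it is captured.

    Local convergence: comparing [x_1] with the competitor [xs] bounds
    [L z_1 + a |z_1 - z_0|^2] by a quantity that tends to the minimum of [L]
    when [z_0] tends to [(xs, ys)].  As [L z_1] is at least that minimum, the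
    first step is small, the sequence is captured, and the limit has the
    minimal value of [L]. *)

(** * The Euclidean norm on row vectors *)

Section Euclidean.
Set Implicit Arguments.
Unset Strict Implicit.
Context {R : realType} {N : nat}.
Implicit Types (x y z : 'rV[R]_N).

Lemma dotvC x y : dotv x y = dotv y x.
Proof. by apply: eq_bigr => i _; rewrite mulrC. Qed.

Lemma dotvDl x y z : dotv (x + y) z = dotv x z + dotv y z.
Proof. by rewrite -big_split; apply: eq_bigr => i _; rewrite mxE mulrDl. Qed.

Lemma dotvZl a x y : dotv (a *: x) y = a * dotv x y.
Proof.
by rewrite /dotv mulr_sumr; apply: eq_bigr => i _; rewrite mxE mulrA.
Qed.

Lemma dotvNl x y : dotv (- x) y = - dotv x y.
Proof. by rewrite -scaleN1r dotvZl mulN1r. Qed.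

Lemma dotvDr x y z : dotv z (x + y) = dotv z x + dotv z y.
Proof. by rewrite dotvC dotvDl !(dotvC z). Qed.

Lemma dotvZr a x y : dotv y (a *: x) = a * dotv y x.
Proof. by rewrite dotvC dotvZl (dotvC y). Qed.

Lemma dotvNr x y : dotv y (- x) = - dotv y x.
Proof. by rewrite dotvC dotvNl (dotvC y). Qed.

Definition dotvE := (dotvDl, dotvDr, dotvNl, dotvNr, dotvZl, dotvZr).

Lemma dotvv_ge0 x : 0 <= dotv x x.
Proof. by apply: sumr_ge0 => i _; rewrite -expr2 sqr_ge0. Qed.

Lemma enorm_ge0 x : 0 <= enorm x.
Proof. exact: sqrtr_ge0. Qed.

Lemma enorm_sqr x : enorm x ^+ 2 = dotv x x.
Proof. by rewrite sqr_sqrtr// dotvv_ge0. Qed.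

Lemma enormN x : enorm (- x) = enorm x.
Proof. by rewrite /enorm !dotvE opprK. Qed.

Lemma enormC x y : enorm (x - y) = enorm (y - x).
Proof. by rewrite -enormN opprB. Qed.

Lemma normr_le_enorm x : `|x| <= enorm x.
Proof.
rewrite [leLHS]mx_normrE; apply/bigmax_leP; split=> [|[i j] _ /=].
  exact: enorm_ge0.
rewrite (ord1 i) -sqrtr_sqr ler_sqrt ?dotvv_ge0// /dotv (bigD1 j)//= -expr2.
by rewrite lerDl; apply: sumr_ge0 => k _; rewrite -expr2 sqr_ge0.
Qed.

Lemma enorm_le_normr x : enorm x <= N.+1%:R * `|x|.
Proof.
have N0 : (0 : R) <= N.+1%:R by rewrite ler0n.
rewrite -[leRHS]ger0_norm ?mulr_ge0// -sqrtr_sqr ler_sqrt ?sqr_ge0//.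
apply: (@le_trans _ _ (\sum_(i < N) `|x| ^+ 2)); last first.
  rewrite sumr_const card_ord -(mulr_natl (_ ^+ 2)) exprMn ler_wpM2r ?sqr_ge0//.
  by rewrite -natrX ler_nat; apply: leq_trans (leq_pexp2l _ (isT : (0 < 2)%N)).
apply: ler_sum => i _; rewrite -expr2 (le_trans (ler_norm _))// normrX.
rewrite lerXn2r ?nnegrE//.
rewrite [leRHS]mx_normrE.
exact: (le_bigmax_cond _ (fun ij : 'I_1 * 'I_N => `|x ij.1 ij.2|)
  (j := (ord0, i))).
Qed.

Lemma enorm_eq0 x : enorm x = 0 -> x = 0.
Proof.
move=> x0; apply/normr0_eq0/le_anti.
by rewrite normr_ge0 -x0 normr_le_enorm.
Qed.

Lemma enorm_gt0 x : x != 0 -> 0 < enorm x.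
Proof.
rewrite lt_def enorm_ge0 andbT; apply: contra => /eqP x0.
exact/eqP/enorm_eq0.
Qed.

Lemma enorm0 : enorm (0 : 'rV[R]_N) = 0.
Proof.
apply/le_anti; rewrite enorm_ge0 andbT (le_trans (enorm_le_normr _))//.
by rewrite normr0 mulr0.
Qed.

(** Cauchy-Schwarz: for nonzero vectors, expand the square of
    [|y| x - |x| y]. *)
Lemma dotv_le_enorm x y : dotv x y <= enorm x * enorm y.
Proof.
have [->|x0] := eqVneq x 0.
  by rewrite -[X in dotv X](scale0r 0) dotvZl mul0r mulr_ge0 ?enorm_ge0.
have [->|y0] := eqVneq y 0.
  by rewrite -[X in dotv _ X](scale0r 0) dotvZr mul0r mulr_ge0 ?enorm_ge0.
have := dotvv_ge0 (enorm y *: x - enorm x *: y).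
rewrite !dotvE -!enorm_sqr (dotvC y x).
set a := enorm x; set b := enorm y; set c := dotv x y => h.
have a0 : 0 < a := enorm_gt0 x0.
have b0 : 0 < b := enorm_gt0 y0.
rewrite -(ler_pM2l (mulr_gt0 a0 b0)); nra.
Qed.

Lemma enormD x y : enorm (x + y) <= enorm x + enorm y.
Proof.
have h := dotv_le_enorm x y.
rewrite -(@ler_pXn2r _ 2)// ?nnegrE ?addr_ge0 ?enorm_ge0//.
rewrite enorm_sqr !dotvE -!enorm_sqr (dotvC y x); nra.
Qed.

Lemma enorm_distD z x y : enorm (x - y) <= enorm (x - z) + enorm (z - y).
Proof. by rewrite -[X in enorm X](subrKA z) enormD. Qed.

(** The topology is that of the sup norm, which is equivalent to [enorm]. *)
Lemma cvg_enormP (u : nat -> 'rV[R]_N) (l : 'rV[R]_N) :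
  u @ \oo --> l <->
  forall e, 0 < e -> exists K, forall k, (K <= k)%N -> enorm (u k - l) < e.
Proof.
split=> [/cvgrPdist_lt ul e e0|ul].
  have N0 : (0 : R) < N.+1%:R by rewrite ltr0n.
  have [K _ Kl] := ul (e / N.+1%:R) (divr_gt0 e0 N0).
  exists K => k kK; rewrite enormC (le_lt_trans (enorm_le_normr _))// mulrC.
  by rewrite -ltr_pdivlMr//; exact: Kl.
apply/cvgrPdist_lt => e e0; have [K Kl] := ul e e0.
exists K => // k /= kK; rewrite (le_lt_trans (normr_le_enorm _))// enormC.
exact: Kl.
Qed.

Lemma nbhs_enorm x (U : set 'rV[R]_N) :
  nbhs x U -> exists2 r, 0 < r & forall y, enorm (y - x) < r -> U y.
Proof.
case/nbhs_ballP => r /= r0 rU; exists r => // y yx; apply: rU.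
by rewrite -ball_normE/= (le_lt_trans (normr_le_enorm _))// enormC.
Qed.

Lemma closed_enorm (A : set 'rV[R]_N) x : closed A ->
  (forall e, 0 < e -> exists2 y, A y & enorm (y - x) < e) -> A x.
Proof.
move=> Acl Ax; apply: Acl => U /nbhs_enorm [r r0 rU].
by have [y Ay /rU Uy] := Ax r r0; exists y.
Qed.

(** Bolzano-Weierstrass for a sequence of which only a subsequence is known to
    be bounded. *)
Lemma frequently_bounded_cluster (z : nat -> 'rV[R]_N) (A : R) :
  (forall K, exists2 k, (K <= k)%N & enorm (z k) <= A) ->
  exists zb, forall e K, 0 < e ->
    exists2 k, (K <= k)%N & enorm (z k - zb) < e.
Proof.
move=> zA; have /choice[f fP] : forall K, exists k,
    (K <= k)%N /\ enorm (z k) <= A.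
  by move=> K; have [k Kk zk] := zA K; exists k.
pose B := [set x : 'rV[R]_N | `|x| <= A].
have cB : compact B.
  apply: bounded_closed_compact.
    exists A; split; first exact: num_real.
    by move=> M AM x /= xA; rewrite (le_trans xA)// ltW.
  rewrite (_ : B = Num.norm @^-1` [set t : R | t <= A])//.
  by apply: closed_comp => [x _|]; [exact: norm_continuous|exact: closed_le].
have [zb [_ zcl]] : B `&` cluster ((z \o f) @ \oo) !=set0.
  apply: cB; exists 0%N => // k _ /=.
  exact: le_trans (normr_le_enorm _) (fP k).2.
exists zb => e K e0.
have N0 : (0 : R) < N.+1%:R by rewrite ltr0n.
have [_ [[k kK <-]]] : [set z (f k) | k in [set k | (K <= k)%N]] `&`
    ball zb (e / N.+1%:R) !=set0.
  apply: zcl; last exact: nbhsx_ballx (divr_gt0 e0 N0).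
  by exists K => // k kK /=; exists k.
rewrite -ball_normE/= => zk; exists (f k); first exact: leq_trans (fP k).1.
rewrite enormC (le_lt_trans (enorm_le_normr _))// mulrC -ltr_pdivlMr//.
Qed.

Lemma nonincreasing_Cauchy (W : nat -> R) (m : R) :
  (forall k, W k.+1 <= W k) -> (forall k, m <= W k) ->
  forall e, 0 < e -> exists K, forall j k, (K <= j <= k)%N -> W j - W k < e.
Proof.
move=> Wd Wm e e0.
have Wh : {homo W : n m / (n <= m)%N >-> m <= n}.
  by apply/nonincreasing_seqP.
have Wc : W @ \oo --> inf (range W).
  by apply: nonincreasing_cvgn => //; exists m => _ [k _ <-].
have e20 : 0 < e / 2 by rewrite divr_gt0.
have [K _ KW] := (cvgrPdist_lt _ _).1 Wc _ e20.
exists K => j k /andP[Kj jk].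
have := KW j Kj; have := KW k (leq_trans Kj jk) => /=.
rewrite !ltr_norml => /andP[h1 h2] /andP[h3 h4]; lra.
Qed.

(** [W k] bounds the length of the tail that starts at [z k], so a tail of the
    sequence stays in a small ball when [W] is almost stationary. *)
Lemma finite_length_cvg (z : nat -> 'rV[R]_N) (W : nat -> R) :
  (forall k, 0 <= W k) ->
  (forall k, enorm (z k.+1 - z k) <= W k - W k.+1) ->
  exists l : 'rV[R]_N, z @ \oo --> l.
Proof.
move=> W0 zW.
have Wd k : W k.+1 <= W k.
  by rewrite -subr_ge0 (le_trans _ (zW k))// enorm_ge0.
have zjk j i : enorm (z (j + i)%N - z j) <= W j - W (j + i)%N.
  elim: i => [|i IH]; first by rewrite addn0 !subrr enorm0.
  rewrite addnS (le_trans (enorm_distD (z (j + i)%N) _ _))//.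
  by have := zW (j + i)%N; lra.
apply/cvg_ex; apply/cauchy_cvgP/cauchy_exP => e e0.
have [K KW] := nonincreasing_Cauchy Wd W0 e0.
exists (z K); exists K => // k /= Kk; rewrite -ball_normE/=.
rewrite (le_lt_trans (normr_le_enorm _))// enormC -(subnKC Kk).
by rewrite (le_lt_trans (zjk _ _))// KW// leqnn leq_addr.
Qed.

End Euclidean.

(** * Desingularizing functions *)

Section Desingularization.
Set Implicit Arguments.
Unset Strict Implicit.
Context {R : realType} {eta : \bar R} {phi : R -> R}.
Context (phiP : desingularizing eta phi).

(** A concave function lies below its tangent at [u].  By concavity the slope
    between [u] and [u - t (u - v)] is at most the slope between [u] and [v];
    let [t] tend to 0.  The point [v = 0] is included, although [phi] need not
    be differentiable there. *)
Lemma desingularizing_gradient (u v : R) :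
  0 < u -> (u%:E < eta)%E -> 0 <= v <= u ->
  derive1 phi u * (u - v) <= phi u - phi v.
Proof.
have [phi0 _ phiC _ phiD] := phiP.
move=> u0 ueta /andP[v0]; rewrite le_eqVlt => /predU1P[->|vu].
  by rewrite !subrr mulr0.
have [du _ _] := phiD u u0 ueta.
rewrite -ler_pdivlMr ?subr_gt0//.
have dcvg : h^-1 *: (phi (h *: 1 + u) - phi u) @[h --> 0^'] --> derive1 phi u.
  by rewrite derive1E; exact: du.
apply/ler_addgt0Pr => e e0.
have /nbhs_ballP[d /= d0 dP] : nbhs (0 : R) (fun h => h != 0 ->
    `|derive1 phi u - h^-1 *: (phi (h *: 1 + u) - phi u)| < e).
  exact: (cvgrPdist_lt _ _).1 dcvg e e0.
pose t := Num.min (d / 2) (u - v) / (u - v).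
have uv0 : 0 < u - v by rewrite subr_gt0.
have m0 : 0 < Num.min (d / 2) (u - v) by rewrite lt_min uv0 divr_gt0.
have t0 : 0 < t by rewrite divr_gt0.
have t1 : t <= 1 by rewrite ler_pdivrMr// mul1r ge_min lexx orbT.
have tuv : t * (u - v) = Num.min (d / 2) (u - v) by rewrite divfK// gt_eqF.
have tuvd : t * (u - v) < d.
  by rewrite tuv gt_min; apply/orP; left; lra.
have s0 : 0 < t * (u - v) by rewrite mulr_gt0.
have veta : (v%:E < eta)%E by rewrite (lt_trans _ ueta)// lte_fin.
have := phiC (Itv01 (ltW t0) t1) v u.
rewrite !inE/= => /(_ (conj v0 veta) (conj (ltW u0) ueta)).
rewrite !convRE/= => cvx.
have {}cvx : t * phi v + (1 - t) * phi u <= phi (u - t * (u - v)).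
  have -> : u - t * (u - v) = t * v + (1 - t) * u by ring.
  have : - phi (t * v + (1 - t) * u) <= t * - phi v + (1 - t) * - phi u := cvx.
  lra.
have := dP (- (t * (u - v))).
rewrite /ball/= sub0r opprK (gtr0_norm s0) => /(_ tuvd).
rewrite oppr_eq0 (gt_eqF s0) => /(_ isT).
rewrite [_ *: 1]mulr1 [- _ + u]addrC => /ltW.
rewrite ler_norml => /andP[_].
set A := derive1 phi u; set B := phi (u - _) in cvx *.
rewrite /GRing.scale/= invrN mulNr opprK => h.
have h2 : A * (t * (u - v)) + (B - phi u) <= e * (t * (u - v)).
  rewrite -ler_pdivrMr// (_ : _ / _ = A + (t * (u - v))^-1 * (B - phi u))//.
  by field; rewrite !gt_eqF.
rewrite -(@ler_pM2r _ (t * (u - v)))// mulrDl.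
have -> : (phi u - phi v) / (u - v) * (t * (u - v)) = t * (phi u - phi v).
  by field; rewrite gt_eqF.
lra.
Qed.

Lemma desingularizing_small (e : R) : 0 < e ->
  exists2 d, 0 < d & forall s, 0 <= s < d -> (s%:E < eta)%E -> phi s < e.
Proof.
have [phi0 phic _ phiz phiD] := phiP => e0.
have [eta0|eta0] := leP eta 0%:E.
  exists 1 => // s /andP[s0 _] /lt_le_trans /(_ eta0).
  by rewrite lte_fin ltNge s0.
pose I := [set s : R^o | 0 <= s /\ (s%:E < eta)%E].
have c0 : phi x @[x --> within I (nbhs (0 : R))] --> phi 0.
  have := phic (0 : R); rewrite /continuous_at nbhs_subspace_in//; apply.
have /nbhs_ballP : nbhs (0 : R) (fun s => I s -> `|phi 0 - phi s| < e).
  exact: (cvgrPdist_lt _ _).1 c0 e e0.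
case/nbhs_ballP => d /= d0 dP; exists d => // s /andP[s0 sd] seta.
have := dP s; rewrite /ball/= phiz !sub0r !normrN ger0_norm// => /(_ sd).
by move=> /(_ (conj s0 seta)); exact: le_lt_trans (ler_norm _).
Qed.

End Desingularization.

(** * Subgradients and capture by the Kurdyka-Lojasiewicz inequality *)

Section Subgradients.
Set Implicit Arguments.
Unset Strict Implicit.
Context {R : realType} {N : nat}.
Implicit Types (h : 'rV[R]_N -> \bar R) (x xs : 'rV[R]_N).

(** A quadratic error [K |y - x|^2], divided by [|y - x|], is negligible near
    [x].  Values [+oo] of [h] only help. *)
Lemma proximal_frechet_subdiff h x xs (hx K : R) : h x = hx%:E -> 0 <= K ->
  (forall y, ((hx + dotv xs (y - x) - K * enorm (y - x) ^+ 2)%:E <= h y)%E) ->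
  frechet_subdiff h x xs.
Proof.
move=> hxE K0 hP; split; first by rewrite /edom/= hxE ltry.
rewrite limf_einfE; apply/lee_addgt0Pr => e e0.
have K1 : 0 < K + 1 by rewrite ltr_wpDl.
have N0 : (0 : R) < N.+1%:R by rewrite ltr0n.
pose r := e / (K + 1) / N.+1%:R.
have r0 : 0 < r by rewrite !divr_gt0.
pose V := [set y : 'rV[R]_N | enorm (x - y) < e / (K + 1) /\ y != x].
have xV : x^' V.
  apply/nbhs_ballP; exists r => //= y; rewrite -ball_normE/= => xy yx.
  split => //.
  by rewrite (le_lt_trans (enorm_le_normr _))// mulrC -ltr_pdivlMr.
apply: (@le_trans _ _ ((- e)%:E + e%:E)%E); first by rewrite -EFinD addNr.
rewrite leeD2r//; apply: le_trans (ereal_sup_ubound _); last first.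
  by exists V; [exact: xV|].
apply: le_ereal_inf_tmp => _ [y [yx ynx] <-].
have d0 : 0 < enorm (x - y) by rewrite enorm_gt0// subr_eq0 eq_sym.
have := hP y; rewrite hxE; case: (h y) => [hy| |].
- rewrite lee_fin (enormC y) => hyP.
  rewrite -!EFinB -EFinM lee_fin mulrC ler_pdivlMr//.
  have : enorm (x - y) * (K + 1) < e by rewrite -ltr_pdivlMr.
  nra.
- by move=> _; rewrite /= gt0_muley ?leey// lte_fin invr_gt0.
- by rewrite leeNy_eq.
Qed.

Lemma frechet_subdiff_subdiff h x xs : frechet_subdiff h x xs -> subdiff h x xs.
Proof.
move=> hxs; split; first by case: hxs.
exists (fun=> x), (fun=> xs); split => //; exact: cvg_cst.
Qed.

Lemma edist_le_enorm x (A : set 'rV[R]_N)  y :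
  A y -> (Defs.edist x A <= (enorm (x - y))%:E)%E.
Proof. by move=> Ay; apply: ereal_inf_lbound; exists y. Qed.

(** [hv k] is the value of [h] at [z k.+1]: nothing is known of [h] at [z 0],
    which only enters through the length of the first step.  The last
    conclusion says that [hv] converges to [h zb] although the limit of [z]
    may differ from [zb]. *)
Theorem KL_descent_capture h zb (l a b : R) :
  h zb = l%:E -> KL_property h zb -> 0 < a -> 0 < b ->
  exists2 eps, 0 < eps &
  forall (z g : nat -> 'rV[R]_N) (hv : nat -> R),
    (forall k, h (z k.+1) = (hv k)%:E) ->
    (forall k, hv k.+1 + a * enorm (z k.+2 - z k.+1) ^+ 2 <= hv k) ->
    (forall k, subdiff h (z k.+1) (g k)) ->
    (forall k, enorm (g k) <= b * enorm (z k.+1 - z k)) ->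
    (forall k, l <= hv k) ->
    enorm (z 1%N - zb) < eps -> enorm (z 1%N - z 0%N) < eps ->
    hv 0%N < l + eps ->
    (exists zoo : 'rV[R]_N, z @ \oo --> zoo) /\
    (forall e, 0 < e -> exists K, forall k, (K <= k)%N -> hv k < l + e).
Proof.
move=> hzb [_ [eta [U [phi [eta0 /nbhs_enorm[r r0 rU] phiP KL]]]]] a0 b0.
have c0 : 0 < b / a by rewrite divr_gt0.
have r30 : 0 < r / 3 by rewrite divr_gt0.
have [d d0 dP] := desingularizing_small phiP (divr_gt0 r30 c0).
have [d' d'0 d'P] : exists2 d', 0 < d' & (d'%:E <= eta)%E.
  case: eta eta0 {phiP KL dP} => [t| |//].
    by rewrite lte_fin => t0; exists t.
  by exists 1; rewrite ?leey.
(* the distance to zb, the first step and the term in phi each get r / 3 *)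
exists (Num.min (r / 3) (Num.min d d')); first by rewrite !lt_min r30 d0.
move=> z g hv hz desc gP gb hvl.
rewrite !lt_min => /andP[z1 _] /andP[z01 _] hv0.
have {hv0} [hv0d hv0d'] : hv 0%N - l < d /\ hv 0%N - l < d'.
  by move: hv0; rewrite addrC -ltrBlDr !lt_min => /and3P[].
have [phi0 _ _ phiz phiD] := phiP.
pose dd k := enorm (z k.+1 - z k).
have ddE k : enorm (z k.+1 - z k) = dd k by [].
have dd0 k : 0 <= dd k by exact: enorm_ge0.
have hvd k : hv k.+1 <= hv k.
  by apply: le_trans (desc k); rewrite lerDl mulr_ge0 ?sqr_ge0// ltW.
have hv0k k : hv k <= hv 0%N by elim: k => // k; exact: le_trans.
have hveta k : ((hv k - l)%:E < eta)%E.
  by apply: lt_le_trans d'P; rewrite lte_fin (le_lt_trans _ hv0d')// lerB.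
have phik0 k : 0 <= phi (hv k - l) by apply: phi0; rewrite /= subr_ge0.
have KLk k : enorm (z k.+1 - zb) < r -> l < hv k ->
    1 <= derive1 phi (hv k - l) * (b * dd k).
  move=> zk lk; have lk0 : 0 < hv k - l by rewrite subr_gt0.
  have [_ _ dphi] := phiD _ lk0 (hveta k).
  have := KL (z k.+1) (rU _ zk); rewrite hz hzb lte_fin => /(_ lk).
  rewrite -lteBlDl// -EFinB => /(_ (hveta k)) /=.
  move=> /le_trans; rewrite -lee_fin EFinM; apply.
  rewrite lee_pmul2l// (le_trans (edist_le_enorm _ (gP k)))//.
  rewrite lee_fin sub0r enormN.
  exact: gb.
(* if hv has reached l, it is stationary and the next step vanishes *)
have step k : enorm (z k.+1 - zb) < r ->
    2 * dd k.+1 + b / a * phi (hv k.+1 - l) <= dd k + b / a * phi (hv k - l).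
  move=> zk; have := hvl k; rewrite le_eqVlt => /predU1P[lk|lk].
    have hk1 : hv k.+1 = hv k by apply/le_anti; rewrite hvd -lk hvl.
    have : dd k.+1 = 0.
      apply/eqP; rewrite -sqrf_eq0 eq_le sqr_ge0 andbT -(pmulr_rle0 _ a0).
      by have := desc k; rewrite hk1 /dd; lra.
    by move=> ->; rewrite hk1; have := dd0 k; lra.
  have lk0 : 0 < hv k - l by rewrite subr_gt0.
  have [_ _ dphi] := phiD _ lk0 (hveta k).
  have kl := KLk k zk lk.
  have gr : derive1 phi (hv k - l) * (hv k - hv k.+1) <=
      phi (hv k - l) - phi (hv k.+1 - l).
    rewrite [hv k - hv k.+1](_ : _ = (hv k - l) - (hv k.+1 - l)); last by ring.
    apply: (desingularizing_gradient phiP) => //.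
    by rewrite subr_ge0 hvl lerB.
  have ph0 : 0 <= phi (hv k - l) - phi (hv k.+1 - l).
    by apply: le_trans gr; rewrite mulr_ge0 ?(ltW dphi)// subr_ge0.
  have {}desc : a * dd k.+1 ^+ 2 <= hv k - hv k.+1 by rewrite lerBrDl.
  have sq : dd k.+1 ^+ 2 <=
      dd k * (b / a * (phi (hv k - l) - phi (hv k.+1 - l))).
    rewrite -(ler_pM2l a0) (le_trans desc)//.
    rewrite [leRHS](_ : _ = b * dd k * (phi (hv k - l) - phi (hv k.+1 - l))).
      have bd0 : 0 <= b * dd k by rewrite mulr_ge0// ltW.
      apply: le_trans (ler_wpM2l bd0 gr).
      have h0 : 0 <= hv k - hv k.+1 by rewrite subr_ge0.
      by have := ler_wpM2r h0 kl; lra.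
    by field; rewrite gt_eqF.
  have := mulr_ge0 (ltW c0) ph0; move: sq; rewrite mulrBr.
  move: (dd0 k) (dd0 k.+1); move: (dd k) (dd k.+1) (b / a * _) (b / a * _).
  move=> p q t s p0 q0 sq st0; rewrite leNgt; apply/negP => lt.
  have : (p + (t - s)) * (p + (t - s)) < 2 * q * (2 * q).
    by have w0 : 0 <= p + (t - s); [rewrite addr_ge0|apply: ltr_pM => //; lra].
  have := sqr_ge0 (p - (t - s)); lra.
(* the Lyapunov quantity that keeps the sequence in the ball of radius r *)
have Vk k : enorm (z k.+1 - zb) + dd k + b / a * phi (hv k - l) < r.
  elim: k => [|k IH].
    have h0 : b / a * phi (hv 0%N - l) < r / 3.
      by rewrite mulrC -ltr_pdivlMr// dP// subr_ge0 hvl.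
    by have := ddE 0%N; lra.
  have zk : enorm (z k.+1 - zb) < r.
    by have := dd0 k; have := mulr_ge0 (ltW c0) (phik0 k); lra.
  have := step k zk; have := enorm_distD (z k.+1) (z k.+2) zb.
  by rewrite ddE; lra.
have zball k : enorm (z k.+1 - zb) < r.
  by have := Vk k; have := dd0 k; have := mulr_ge0 (ltW c0) (phik0 k); lra.
have [zoo zzoo] : exists l : 'rV[R]_N, z @ \oo --> l.
  have [||l' zl'] := @finite_length_cvg _ _ (fun k => z k.+1)
      (fun k => dd k + b / a * phi (hv k - l)).
  - by move=> k; rewrite addr_ge0// mulr_ge0// ltW.
  - by move=> k; rewrite ddE; have := step k (zball k); lra.
  - by exists l'; rewrite -cvg_shiftS.
split=> [|e e0]; first by exists zoo.
(* concavity with endpoint 0 bounds phi' (s) by phi (s) / s, so the inequality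
   controls the excess of hv over l by the length of the step *)
have hdd k : hv k - l <= a * r * dd k.
  have := hvl k; rewrite le_eqVlt => /predU1P[<-|lk].
    by rewrite subrr !mulr_ge0// ltW.
  have lk0 : 0 < hv k - l by rewrite subr_gt0.
  have := desingularizing_gradient phiP lk0 (hveta k) (v := 0).
  rewrite lexx ltW// subr0 phiz subr0 => /(_ isT) gr.
  have kl := KLk k (zball k) lk.
  have bph : b * phi (hv k - l) <= a * r.
    rewrite -ler_pdivrMl// mulrA [_^-1 * _]mulrC.
    by have := Vk k; have := dd0 k; have := enorm_ge0 (z k.+1 - zb); lra.
  apply: le_trans (ler_wpM2r (dd0 k) bph).
  have := ler_wpM2r (mulr_ge0 (ltW b0) (dd0 k)) gr.
  have := ler_wpM2r (ltW lk0) kl; lra.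
have ar0 : 0 < a * r by rewrite mulr_gt0.
have e20 : 0 < e / (a * r) / 2 by rewrite !divr_gt0.
have [K zK] := (cvg_enormP _ _).1 zzoo _ e20.
exists K => k kK; rewrite -ltrBlDl (le_lt_trans (hdd k))// mulrC -ltr_pdivlMr//.
have := zK k kK; have := zK k.+1 (leqW kK); rewrite [enorm (z k - _)]enormC.
have := enorm_distD zoo (z k.+1) (z k); rewrite ddE; lra.
Qed.
End Subgradients.

(** * The function [LCD] and one step of the algorithm *)

Section AlternatingProjections.
Set Implicit Arguments.
Unset Strict Implicit.
Context {R : realType} {n : nat}.
Implicit Types (x y u v : 'rV[R]_n) (C D : set 'rV[R]_n).

Lemma dotv_row_mx x y u v :
  dotv (row_mx x y) (row_mx u v) = dotv x u + dotv y v.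
Proof.
rewrite /dotv big_split_ord/=; congr (_ + _); apply: eq_bigr => i _.
  by rewrite !row_mxEl.
by rewrite !row_mxEr.
Qed.

Lemma enorm_row_mx_sqr x y :
  enorm (row_mx x y) ^+ 2 = enorm x ^+ 2 + enorm y ^+ 2.
Proof. by rewrite !enorm_sqr dotv_row_mx. Qed.

Lemma enorm_row_mx_le x y : enorm (row_mx x y) <= enorm x + enorm y.
Proof.
rewrite -(@ler_pXn2r _ 2)// ?nnegrE ?addr_ge0 ?enorm_ge0//.
rewrite enorm_row_mx_sqr; have := mulr_ge0 (enorm_ge0 x) (enorm_ge0 y); lra.
Qed.

Lemma enorm_le_row_mx x y :
  (enorm x <= enorm (row_mx x y)) * (enorm y <= enorm (row_mx x y)).
Proof.
by split; rewrite -(@ler_pXn2r _ 2)// ?nnegrE ?enorm_ge0// enorm_row_mx_sqr;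
  have := sqr_ge0 (enorm x); have := sqr_ge0 (enorm y); lra.
Qed.

Definition half_sqdist x y : R := 2^-1 * enorm (x - y) ^+ 2.

Lemma half_sqdist_ge0 x y : 0 <= half_sqdist x y.
Proof. by rewrite mulr_ge0 ?sqr_ge0// invr_ge0. Qed.

Lemma LCD_row_mx C D x y : C x -> D y ->
  LCD C D (row_mx x y) = (half_sqdist x y)%:E.
Proof.
move=> Cx Dy; rewrite /LCD row_mxKl row_mxKr /indic_fun.
by rewrite !mem_set// add0e adde0.
Qed.

Lemma LCD_outside C D x y : ~ (C x /\ D y) -> LCD C D (row_mx x y) = +oo%E.
Proof.
move=> nCD; rewrite /LCD row_mxKl row_mxKr /indic_fun.
case: ifPn => [/set_mem Cx|_]; case: ifPn => [/set_mem Dy|_] //.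
by case: nCD.
Qed.

Lemma half_sqdist_continuous x y e : 0 < e -> exists2 d, 0 < d &
  forall u v, enorm (row_mx u v - row_mx x y) < d ->
    `|half_sqdist u v - half_sqdist x y| < e.
Proof.
move=> e0; rewrite /half_sqdist; set t := enorm (x - y).
have t0 : 0 <= t := enorm_ge0 _.
have M0 : 0 < 2 * t + 2 by lra.
exists (Num.min 2^-1 (e / (2 * t + 2))).
  by rewrite lt_min invr_gt0 ltr0n divr_gt0.
move=> u v; rewrite opp_row_mx add_row_mx lt_min ltr_pdivlMr//.
set d := enorm (row_mx _ _) => /andP[d1 dM].
have ux : enorm (u - x) <= d by rewrite enorm_le_row_mx.
have vy : enorm (v - y) <= d by rewrite enorm_le_row_mx.
have d0 : 0 <= d := enorm_ge0 _.
have s0 := enorm_ge0 (u - v); set s := enorm (u - v) in s0 *.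
have st : s <= t + 2 * d.
  have := enorm_distD x u v; have := enorm_distD y x v.
  by rewrite (enormC y v) -/s -/t; lra.
have ts : t <= s + 2 * d.
  have := enorm_distD u x y; have := enorm_distD v u y.
  by rewrite (enormC x u) -/s -/t; lra.
rewrite ltr_norml; apply/andP; split; nra.
Qed.

(** The weighted sum of squares differs from [(l + 1)] times the squared
    distance to the weighted mean by a term independent of [w]. *)
Lemma proj_weighted_minimizes C (l : R) x y xb : 0 < l ->
  Defs.proj C ((l + 1)^-1 *: (l *: x + y)) xb ->
  forall u, C u -> enorm (xb - y) ^+ 2 + l * enorm (xb - x) ^+ 2 <=
                   enorm (u - y) ^+ 2 + l * enorm (u - x) ^+ 2.
Proof.
move=> l0 [_ xbP] u /xbP; set p := _ *: _ => pu.
have l10 : 0 < l + 1 by lra.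
have lp : l *: x + y = (l + 1) *: p by rewrite scalerA divff ?scale1r// gt_eqF.
move: p lp pu => p lp pu.
have E w : enorm (w - y) ^+ 2 + l * enorm (w - x) ^+ 2 =
    (l + 1) * enorm (p - w) ^+ 2 +
    (dotv y y + l * dotv x x - (l + 1) * dotv p p).
  have : dotv (l *: x + y) w = dotv ((l + 1) *: p) w by rewrite lp.
  rewrite !enorm_sqr !dotvE (dotvC w y) (dotvC w x) (dotvC w p); lra.
rewrite !E lerD2r ler_pM2l// lerXn2r ?nnegrE ?enorm_ge0//.
Qed.

(** At the new point [(xb, yb)] the optimality conditions read
    [y - xb + l (x - xb)] normal to [C] and [xb - yb + m (y - yb)] normal to
    [D]; adding the gradient [(xb - yb, yb - xb)] of the smooth term leaves
    quantities that vanish with the step.  The normals are proximal, whence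
    the quadratic error. *)
Lemma alternating_frechet_subdiff C D (l m : R) x y xb yb :
  0 <= l -> 0 <= m -> C xb -> D yb ->
  (forall u, C u -> enorm (xb - y) ^+ 2 + l * enorm (xb - x) ^+ 2 <=
                    enorm (u - y) ^+ 2 + l * enorm (u - x) ^+ 2) ->
  (forall v, D v -> enorm (yb - xb) ^+ 2 + m * enorm (yb - y) ^+ 2 <=
                    enorm (v - xb) ^+ 2 + m * enorm (v - y) ^+ 2) ->
  frechet_subdiff (LCD C D) (row_mx xb yb)
    (row_mx ((y - yb) + l *: (x - xb)) (m *: (y - yb))).
Proof.
move=> l0 m0 Cxb Dyb xbP ybP.
apply: (proximal_frechet_subdiff (LCD_row_mx Cxb Dyb)
  (K := (1 + l + m) / 2)); first by rewrite divr_ge0// !addr_ge0.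
move=> w; rewrite -[w]hsubmxK; set u := lsubmx w; set v := rsubmx w.
have [[Cu Dv]|/LCD_outside ->] := pselect (C u /\ D v); last by rewrite leey.
rewrite LCD_row_mx// lee_fin opp_row_mx add_row_mx dotv_row_mx.
rewrite enorm_row_mx_sqr /half_sqdist.
have := xbP _ Cu; have := ybP _ Dv; have := dotvv_ge0 ((u - xb) - (v - yb)).
have := mulr_ge0 l0 (dotvv_ge0 (v - yb)).
have := mulr_ge0 m0 (dotvv_ge0 (u - xb)).
(* in terms of the displacements U = u - xb and V = v - yb, the conclusion is a
   linear combination of the optimality conditions and of |U - V|^2 >= 0 *)
rewrite (_ : u - y = (u - xb) + (xb - yb) - (y - yb)); last first.
  by rewrite opprB !addrA !subrK.
rewrite (_ : xb - y = (xb - yb) - (y - yb)); last by rewrite opprB addrA subrK.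
rewrite (_ : u - x = (u - xb) - (x - xb)); last by rewrite opprB addrA subrK.
rewrite (_ : v - xb = (v - yb) - (xb - yb)); last by rewrite opprB addrA subrK.
rewrite (_ : v - y = (v - yb) - (y - yb)); last by rewrite opprB addrA subrK.
rewrite (_ : u - v = (u - xb) + (xb - yb) - (v - yb)); last first.
  by rewrite opprB !addrA !subrK.
rewrite (enormC xb x) (enormC yb xb) (enormC yb y).
move: (u - xb) (v - yb) (xb - yb) (x - xb) (y - yb) => U V P X Y.
rewrite !enorm_sqr !dotvE.
rewrite (dotvC P U) (dotvC Y U) (dotvC X U) (dotvC V U) (dotvC Y P) (dotvC V P).
rewrite (dotvC Y V) (dotvC P V); lra.
Qed.

(** A limit of points with Frechet subgradients tending to 0 is critical: the
    convergence of the values, which the limiting subdifferential demands, is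
    automatic as [LCD C D] is continuous on the closed set [C x D]. *)
Lemma subdiff0_closed C D zb : closed C -> closed D ->
  (forall e, 0 < e -> exists x y g, [/\ C x, D y,
     enorm (row_mx x y - zb) < e, enorm g < e
     & frechet_subdiff (LCD C D) (row_mx x y) g]) ->
  [/\ C (lsubmx zb), D (rsubmx zb) & critical_point (LCD C D) zb].
Proof.
move=> Ccl Dcl zP.
have CD : C (lsubmx zb) /\ D (rsubmx zb).
  split.
    apply: (closed_enorm Ccl) => e /zP[x [y [g [Cx Dy + _ _]]]].
    rewrite -[zb in X in X -> _]hsubmxK opp_row_mx add_row_mx => h.
    by exists x => //; apply: le_lt_trans h; rewrite enorm_le_row_mx.
  apply: (closed_enorm Dcl) => e /zP[x [y [g [Cx Dy + _ _]]]].
  rewrite -[zb in X in X -> _]hsubmxK opp_row_mx add_row_mx => h.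
  by exists y => //; apply: le_lt_trans h; rewrite enorm_le_row_mx.
have [Cz Dz] := CD.
have zbE : LCD C D zb = (half_sqdist (lsubmx zb) (rsubmx zb))%:E.
  by rewrite -[in LHS](hsubmxK zb) LCD_row_mx.
split => //; split; first by rewrite /edom/= zbE ltry.
have /choice[f fP] : forall j : nat,
    exists t : 'rV[R]_n * 'rV[R]_n * 'rV[R]_(n + n),
    [/\ C t.1.1, D t.1.2, enorm (row_mx t.1.1 t.1.2 - zb) < j.+1%:R^-1,
      enorm t.2 < j.+1%:R^-1 &
      frechet_subdiff (LCD C D) (row_mx t.1.1 t.1.2) t.2].
  move=> j; have [|x [y [g h]]] := zP j.+1%:R^-1; first by rewrite invr_gt0.
  by exists (x, y, g).
have small e : 0 < e -> exists K, forall j, (K <= j)%N -> (j.+1%:R^-1 : R) < e.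
  by move=> e0; have [K _ Ke] := near_infty_natSinv_lt (PosNum e0); exists K.
have zcv : (fun j => row_mx (f j).1.1 (f j).1.2) @ \oo --> zb.
  apply/cvg_enormP => e /small[K Ke]; exists K => j Kj.
  by have [_ _ h _ _] := fP j; apply: lt_trans h (Ke j Kj).
exists (fun j => row_mx (f j).1.1 (f j).1.2), (fun j => (f j).2); split => //.
- rewrite zbE; apply: (@cvg_trans _
    ((half_sqdist (f j).1.1 (f j).1.2)%:E @[j --> \oo])).
    apply: near_eq_cvg; apply: nearW => j.
    by have [Cj Dj _ _ _] := fP j; rewrite LCD_row_mx.
  apply: cvg_EFin; first exact: nearW.
  apply/cvgrPdist_lt => e e0.
  have [d d0 dP] := half_sqdist_continuous (lsubmx zb) (rsubmx zb) e0.
  have [K KP] := (cvg_enormP _ _).1 zcv _ d0.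
  exists K => // j /= Kj; rewrite distrC; apply: dP.
  by rewrite (hsubmxK zb); exact: KP.
- by move=> j; have [] := fP j.
- apply/cvg_enormP => e /small[K Ke]; exists K => j Kj.
  by have [_ _ _ h _] := fP j; rewrite subr0; apply: lt_trans h (Ke j Kj).
Qed.

End AlternatingProjections.

(** * Estimates along the algorithm *)

Section AlgorithmEstimates.
Set Implicit Arguments.
Unset Strict Implicit.
Context {R : realType} {n : nat} {C D : set 'rV[R]_n} {rm rp : R}.
Context {lam mu : nat -> R} {x y : nat -> 'rV[R]_n}.
Context (rm0 : 0 < rm).
Context (hlam : forall k, rm < lam k < rp) (hmu : forall k, rm < mu k < rp).
Context (Dy0 : D (y 0%N)) (xyP : alternating_projection C D lam mu x y).

Let z k := row_mx (x k) (y k).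

Definition step_subgradient k : 'rV[R]_(n + n) :=
  row_mx ((y k - y k.+1) + (lam k)^-1 *: (x k - x k.+1))
         ((mu k)^-1 *: (y k - y k.+1)).

Lemma alternating_projection_inC k : C (x k.+1).
Proof. by have [[]] := xyP k. Qed.

Lemma alternating_projection_inD k : D (y k).
Proof. by case: k => // k; have [_ []] := xyP k. Qed.

Let step_bounds (s : R) : rm < s < rp -> 0 < s /\ rp^-1 <= s^-1 <= rm^-1.
Proof.
move=> /andP[rms srp]; have s0 : 0 < s := lt_trans rm0 rms.
have rp0 : 0 < rp := lt_trans s0 srp.
by split=> //; rewrite !lef_pV2 ?posrE//; apply/andP; split; exact: ltW.
Qed.

Let stepz k : enorm (z k.+1 - z k) ^+ 2 =
  enorm (x k.+1 - x k) ^+ 2 + enorm (y k.+1 - y k) ^+ 2.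
Proof. by rewrite opp_row_mx add_row_mx enorm_row_mx_sqr. Qed.

(** A competitor [u] other than [x k] is needed at the first step, where
    [x 0] may lie outside [C]. *)
Lemma alternating_projection_descent k u : C u ->
  half_sqdist (x k.+1) (y k.+1) + (2 * rp)^-1 * enorm (z k.+1 - z k) ^+ 2 <=
  half_sqdist u (y k) + (2 * rm)^-1 * enorm (u - x k) ^+ 2.
Proof.
move=> Cu; have [xk yk] := xyP k.
have [l0 /andP[lp lm]] := step_bounds (hlam k).
have [m0 /andP[mp mm]] := step_bounds (hmu k).
rewrite -invr_gt0 in l0; rewrite -invr_gt0 in m0.
have := proj_weighted_minimizes l0 xk Cu.
have := proj_weighted_minimizes m0 yk (alternating_projection_inD k).
rewrite subrr enorm0 stepz /half_sqdist !invfM.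
rewrite (enormC (x k.+1) (y k.+1)) (enormC (x k.+1) (y k)).
have := ler_wpM2r (sqr_ge0 (enorm (x k.+1 - x k))) lp.
have := ler_wpM2r (sqr_ge0 (enorm (y k.+1 - y k))) mp.
have := ler_wpM2r (sqr_ge0 (enorm (u - x k))) lm.
lra.
Qed.

Lemma alternating_projection_decrease k :
  half_sqdist (x k.+2) (y k.+2) + (2 * rp)^-1 * enorm (z k.+2 - z k.+1) ^+ 2 <=
  half_sqdist (x k.+1) (y k.+1).
Proof.
have := alternating_projection_descent k.+1 (alternating_projection_inC k).
by rewrite subrr enorm0 expr0n mulr0 addr0.
Qed.

Lemma step_subgradientP k :
  frechet_subdiff (LCD C D) (z k.+1) (step_subgradient k).
Proof.
have [xk yk] := xyP k.
have [l0 _] := step_bounds (hlam k); have [m0 _] := step_bounds (hmu k).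
rewrite -invr_gt0 in l0; rewrite -invr_gt0 in m0.
apply: alternating_frechet_subdiff; rewrite ?ltW//.
- exact: alternating_projection_inC.
- exact: alternating_projection_inD.
- exact: proj_weighted_minimizes l0 xk.
- exact: proj_weighted_minimizes m0 yk.
Qed.

Lemma step_subgradient_le k :
  enorm (step_subgradient k) <= (1 + 2 * rm^-1) * enorm (z k.+1 - z k).
Proof.
have [l0 /andP[_ lm]] := step_bounds (hlam k).
have [m0 /andP[_ mm]] := step_bounds (hmu k).
rewrite -invr_gt0 in l0; rewrite -invr_gt0 in m0.
apply: le_trans (enorm_row_mx_le _ _) _.
have enZ (a : R) (w : 'rV[R]_n) : 0 <= a -> enorm (a *: w) = a * enorm w.
  move=> a0; rewrite /enorm dotvZl dotvZr mulrA -expr2 sqrtrM ?sqr_ge0//.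
  by rewrite sqrtr_sqr ger0_norm.
have := enormD (y k - y k.+1) ((lam k)^-1 *: (x k - x k.+1)).
rewrite (enZ _ _ (ltW l0)) (enZ _ _ (ltW m0)) (enormC (x k)) (enormC (y k)).
have : enorm (x k.+1 - x k) <= enorm (z k.+1 - z k).
  by rewrite opp_row_mx add_row_mx enorm_le_row_mx.
have : enorm (y k.+1 - y k) <= enorm (z k.+1 - z k).
  by rewrite opp_row_mx add_row_mx enorm_le_row_mx.
have := enorm_ge0 (x k.+1 - x k); have := enorm_ge0 (y k.+1 - y k).
move: (enorm (x k.+1 - x k)) (enorm (y k.+1 - y k)) (enorm (z k.+1 - z k)).
move=> p q s q0 p0 qs ps.
have : (lam k)^-1 * p <= rm^-1 * s by apply: ler_pM => //; exact: ltW.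
have : (mu k)^-1 * q <= rm^-1 * s by apply: ler_pM => //; exact: ltW.
lra.
Qed.

End AlgorithmEstimates.

(** * Convergence *)

Section Convergence.
Set Implicit Arguments.
Unset Strict Implicit.
Context {R : realType} {n : nat} {C D : set 'rV[R]_n} {rm rp : R}.
Context {lam mu : nat -> R}.
Context (Ccl : closed C) (Dcl : closed D) (rm0 : 0 < rm) (rmp : rm < rp).
Context (hlam : forall k, rm < lam k < rp) (hmu : forall k, rm < mu k < rp).

Let a := (2 * rp)^-1.
Let b := 1 + 2 * rm^-1.
Let rp0 : 0 < rp. Proof. exact: lt_trans rmp. Qed.
Let a0 : 0 < a. Proof. by rewrite invr_gt0 mulr_gt0. Qed.
Let b0 : 0 < b. Proof. by rewrite addr_gt0// mulr_gt0// invr_gt0. Qed.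

Lemma alternating_projection_cvg :
  (forall z, dom_subdiff (LCD C D) z -> KL_property (LCD C D) z) ->
  forall x y : nat -> 'rV[R]_n,
    D (y 0%N) -> alternating_projection C D lam mu x y ->
    enorm (row_mx (x k) (y k)) @[k --> \oo] --> +oo \/
    exists2 z : 'rV[R]_(n + n), critical_point (LCD C D) z &
      row_mx (x k) (y k) @[k --> \oo] --> z.
Proof.
move=> KL x y Dy0 xyP; set z := fun k => row_mx (x k) (y k).
have [|/cvgryPge/existsNP[A zA]] := pselect (enorm (z k) @[k --> \oo] --> +oo).
  by left.
right; have [zb zbP] : exists zb, forall e K, 0 < e ->
    exists2 k, (K <= k)%N & enorm (z k - zb) < e.
  apply: (@frequently_bounded_cluster _ _ _ A) => K.
  apply: contrapT => nA; apply: zA; exists K => // k /= Kk.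
  by rewrite leNgt; apply/negP => /ltW zk; apply: nA; exists k.
pose hv k := half_sqdist (x k.+1) (y k.+1).
have desc k : hv k.+1 + a * enorm (z k.+2 - z k.+1) ^+ 2 <= hv k.
  exact: (alternating_projection_decrease rm0 hlam hmu Dy0 xyP).
have hvd k : hv k.+1 <= hv k.
  by apply: le_trans (desc k); rewrite lerDl mulr_ge0 ?sqr_ge0// ltW.
have hv0 k : 0 <= hv k by exact: half_sqdist_ge0.
have steps e : 0 < e -> exists K,
    forall k, (K <= k)%N -> enorm (z k.+1 - z k) < e.
  move=> e0; have ae0 : 0 < a * e ^+ 2 by rewrite mulr_gt0// exprn_gt0.
  have [K KP] := nonincreasing_Cauchy hvd hv0 ae0.
  exists K.+1 => -[//|k] Kk; have := KP k k.+1.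
  rewrite leqnSn andbT => /(_ Kk) h.
  rewrite -(@ltr_pXn2r _ 2)// ?nnegrE ?enorm_ge0 ?(ltW e0)// -(ltr_pM2l a0).
  by have := desc k; lra.
have near_zb e : 0 < e -> exists K, forall K', exists k,
    [/\ (K <= k)%N, (K' <= k)%N, enorm (z k.+1 - z k) < e
      & enorm (z k.+1 - zb) < e].
  move=> e0; have e20 : 0 < e / 2 by rewrite divr_gt0.
  have [K KP] := steps _ e20; exists K => K'.
  have [k Kk zk] := zbP _ (maxn K K') e20.
  move: Kk; rewrite geq_max => /andP[Kk K'k]; exists k; split => //.
    by have := KP k Kk; lra.
  by have := KP k Kk; have := enorm_distD (z k) (z k.+1) zb; lra.
have [Cz Dz zcrit] :
    [/\ C (lsubmx zb), D (rsubmx zb) & critical_point (LCD C D) zb].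
  apply: subdiff0_closed => // e e0.
  have [|K KP] := near_zb (Num.min e (e / b)).
    by rewrite lt_min e0 divr_gt0.
  have [k [_ _]] := KP 0%N.
  rewrite !lt_min => /andP[_ zk] /andP[zkb _].
  exists (x k.+1), (y k.+1).
  exists (step_subgradient k (lam := lam) (mu := mu) (x := x) (y := y)).
  split => //.
  - exact: alternating_projection_inC xyP k.
  - exact: alternating_projection_inD Dy0 xyP k.+1.
  - apply: le_lt_trans (step_subgradient_le rm0 hlam hmu k) _.
    by rewrite mulrC -ltr_pdivlMr.
  - exact: (step_subgradientP rm0 hlam hmu Dy0 xyP).
have zbE : LCD C D zb = (half_sqdist (lsubmx zb) (rsubmx zb))%:E.
  by rewrite -[in LHS](hsubmxK zb) LCD_row_mx.
set l := half_sqdist _ _ in zbE.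
have KLz : KL_property (LCD C D) zb by apply: KL; exists 0.
have [eps eps0 capture] := KL_descent_capture zbE KLz a0 b0.
have hvcl d K : 0 < d -> exists k,
    [/\ (K <= k)%N, enorm (z k.+1 - z k) < d, enorm (z k.+1 - zb) < d
      & `|hv k - l| < d].
  move=> d0.
  have [d' d'0 d'P] := half_sqdist_continuous (lsubmx zb) (rsubmx zb) d0.
  have [|K0 K0P] := near_zb (Num.min d d'); first by rewrite lt_min d0.
  have [k [_ Kk]] := K0P K.
  rewrite !lt_min => /andP[zk _] /andP[zkd zkd']; exists k; split => //.
  by apply: d'P; rewrite (hsubmxK zb).
have hvl k : l <= hv k.
  apply/ler_addgt0Pr => d d0; have [j [kj _ _]] := hvcl d k d0.
  have hvh : {homo hv : i j / (i <= j)%N >-> j <= i}.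
    by apply/nonincreasing_seqP.
  have hjk := hvh _ _ kj.
  by rewrite ltr_norml => /andP[h1 h2]; lra.
have [K [_ zK zKb]] := hvcl eps 0%N eps0.
rewrite ltr_norml => /andP[_ hK].
exists zb => //.
have [||||||||[zoo zzoo] _] := capture (fun k => z (k + K)%N)
  (fun k => step_subgradient (k + K)%N (lam := lam) (mu := mu) (x := x) (y := y))
  (fun k => hv (k + K)%N) => //.
- move=> k; rewrite addSn LCD_row_mx//.
    exact: alternating_projection_inC xyP _.
  exact: alternating_projection_inD Dy0 xyP _.
- by move=> k; rewrite !addSn.
- move=> k; apply: frechet_subdiff_subdiff.
  exact: (step_subgradientP rm0 hlam hmu Dy0 xyP).
- by move=> k; rewrite addSn; exact: (step_subgradient_le rm0 hlam hmu).
- by rewrite add0n; lra.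
have {}zzoo : z @ \oo --> zoo by rewrite -(cvg_shiftn K).
suff -> : zb = zoo by [].
apply/eqP; rewrite -subr_eq0; apply/eqP/enorm_eq0/le_anti.
rewrite enorm_ge0 andbT.
apply/ler_addgt0Pr => e e0; rewrite add0r.
have e20 : 0 < e / 2 by rewrite divr_gt0.
have [K1 K1P] := (cvg_enormP _ _).1 zzoo _ e20.
have [k Kk zk] := zbP _ K1 e20.
have := K1P k Kk; have := enorm_distD (z k) zb zoo.
by rewrite (enormC zb (z k)); lra.
Qed.

(** The radius is chosen so that an excess [d * M] of the value after the first
    step forces this step to be shorter than [eps / 2]. *)
Lemma alternating_projection_local_cvg xs ys : C xs -> D ys ->
  KL_property (LCD C D) (row_mx xs ys) ->
  is_min [set enorm (u - v) | u in C & v in D] (enorm (xs - ys)) ->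
  exists2 eps : R, 0 < eps &
  forall x y : nat -> 'rV[R]_n,
    D (y 0%N) -> alternating_projection C D lam mu x y ->
    enorm (row_mx (x 0%N) (y 0%N) - row_mx xs ys) < eps ->
    exists xoo yoo : 'rV[R]_n,
      row_mx (x k) (y k) @[k --> \oo] --> row_mx xoo yoo /\
      is_min [set enorm (u - v) | u in C & v in D] (enorm (xoo - yoo)).
Proof.
move=> Cxs Dys KLz [_ mind].
have dmin u v : C u -> D v -> enorm (xs - ys) <= enorm (u - v).
  by move=> Cu Dv; apply: mind; exists u => //; exists v.
have zsE := LCD_row_mx Cxs Dys.
set l := half_sqdist xs ys in zsE.
have lmin u v : C u -> D v -> l <= half_sqdist u v.
  move=> Cu Dv; rewrite ler_wpM2l ?invr_ge0// lerXn2r ?nnegrE ?enorm_ge0//.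
  exact: dmin.
have [eps eps0 capture] := KL_descent_capture zsE KLz a0 b0.
set t := enorm (xs - ys) in dmin.
have t0 : 0 <= t := enorm_ge0 _.
pose M := t + 1 + (2 * rm)^-1.
have rmV0 : 0 < (2 * rm)^-1 by rewrite invr_gt0 mulr_gt0.
have M0 : 0 < M by rewrite addr_gt0// ltr_wpDl.
have ae0 : 0 < a * (eps / 2) ^+ 2 by rewrite mulr_gt0// exprn_gt0// divr_gt0.
exists (Num.min (Num.min 1 (eps / 2))
  (Num.min (eps / M) (a * (eps / 2) ^+ 2 / M))).
  by rewrite !lt_min ltr01 !divr_gt0.
move=> x y Dy0 xyP; set z := fun k => row_mx (x k) (y k).
rewrite -/(z 0%N); set d := enorm (z 0%N - _).
rewrite !lt_min -andbA !ltr_pdivlMr// => /and4P[d1 de dM daM].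
have d0 : 0 <= d := enorm_ge0 _.
pose hv k := half_sqdist (x k.+1) (y k.+1).
have desc k : hv k.+1 + a * enorm (z k.+2 - z k.+1) ^+ 2 <= hv k.
  exact: (alternating_projection_decrease rm0 hlam hmu Dy0 xyP).
have hvl k : l <= hv k.
  apply: lmin; first exact: alternating_projection_inC xyP k.
  exact: alternating_projection_inD Dy0 xyP _.
(* the weighted bound for the competitor xs; d <= 1 linearizes the squares *)
have first_step : hv 0%N + a * enorm (z 1%N - z 0%N) ^+ 2 <= l + d * M.
  apply: le_trans (alternating_projection_descent rm0 hlam hmu Dy0 xyP 0 Cxs) _.
  rewrite /l /half_sqdist -/t.
  have xd : enorm (xs - x 0%N) <= d.
    by rewrite /d opp_row_mx add_row_mx enormC enorm_le_row_mx.
  have yd : enorm (xs - y 0%N) <= t + d.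
    apply: le_trans (enorm_distD ys _ _) _; rewrite lerD2l enormC.
    by rewrite /d opp_row_mx add_row_mx enorm_le_row_mx.
  have xd2 : enorm (xs - x 0%N) ^+ 2 <= d.
    have := enorm_ge0 (xs - x 0%N); nra.
  have yd2 : enorm (xs - y 0%N) ^+ 2 <= t ^+ 2 + 2 * d * t + d.
    have := enorm_ge0 (xs - y 0%N); nra.
  have := ler_wpM2l (ltW rmV0) xd2; rewrite /M; lra.
have z10 : enorm (z 1%N - z 0%N) < eps / 2.
  rewrite -(@ltr_pXn2r _ 2)// ?nnegrE ?enorm_ge0 ?divr_ge0 ?(ltW eps0)//.
  by rewrite -(ltr_pM2l a0); have := hvl 0%N; lra.
have [||||||||[zoo zzoo] hvcv] := capture z
  (fun k => step_subgradient k (lam := lam) (mu := mu) (x := x) (y := y)) hv => //.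
- move=> k; rewrite LCD_row_mx//.
    exact: alternating_projection_inC xyP _.
  exact: alternating_projection_inD Dy0 xyP _.
- move=> k; apply: frechet_subdiff_subdiff.
  exact: (step_subgradientP rm0 hlam hmu Dy0 xyP).
- by move=> k; exact: (step_subgradient_le rm0 hlam hmu).
- by have := enorm_distD (z 0%N) (z 1%N) (row_mx xs ys); rewrite -/d; lra.
- by lra.
- have : 0 <= a * enorm (z 1%N - z 0%N) ^+ 2 by rewrite mulr_ge0 ?sqr_ge0// ltW.
  lra.
have CDoo : C (lsubmx zoo) /\ D (rsubmx zoo).
  split; [apply: (closed_enorm Ccl)|apply: (closed_enorm Dcl)] => e e0;
    have [K /(_ K.+1 (leqnSn K))] := (cvg_enormP _ _).1 zzoo e e0;
    rewrite -[zoo in X in X -> _]hsubmxK opp_row_mx add_row_mx => h.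
    exists (x K.+1); first exact: alternating_projection_inC xyP _.
    by apply: le_lt_trans h; rewrite enorm_le_row_mx.
  exists (y K.+1); first exact: alternating_projection_inD Dy0 xyP _.
  by apply: le_lt_trans h; rewrite enorm_le_row_mx.
have [Coo Doo] := CDoo.
exists (lsubmx zoo), (rsubmx zoo); split; first by rewrite hsubmxK.
split; first by exists (lsubmx zoo) => //; exists (rsubmx zoo).
suff doo : enorm (lsubmx zoo - rsubmx zoo) <= t.
  by move=> _ [u Cu [v Dv <-]]; exact: le_trans (dmin _ _ Cu Dv).
rewrite -(@ler_pXn2r _ 2)// ?nnegrE ?enorm_ge0//.
suff : half_sqdist (lsubmx zoo) (rsubmx zoo) <= l.
  by rewrite /l /half_sqdist -/t; lra.
apply/ler_addgt0Pr => e e0; have e20 : 0 < e / 2 by rewrite divr_gt0.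
have [d' d'0 d'P] := half_sqdist_continuous (lsubmx zoo) (rsubmx zoo) e20.
have [K1 K1P] := (cvg_enormP _ _).1 zzoo _ d'0.
have [K2 K2P] := hvcv _ e20.
have := K2P (maxn K1 K2) (leq_maxr _ _).
have := d'P (x (maxn K1 K2).+1) (y (maxn K1 K2).+1).
rewrite hsubmxK => /(_ (K1P _ (leqW (leq_maxl _ _)))).
by rewrite ltr_norml -/(hv _) => /andP[h1 h2]; lra.
Qed.

End Convergence.

Theorem corollary12 (R : realType) (n : nat) (C D : set 'rV[R]_n)
    (rm rp : R) (lam mu : nat -> R)
    (C0 : C !=set0) (Ccl : closed C) (D0 : D !=set0) (Dcl : closed D)
    (rm0 : 0 < rm) (rmp : rm < rp)
    (hlam : forall k, rm < lam k < rp) (hmu : forall k, rm < mu k < rp) :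
  ((forall z, dom_subdiff (LCD C D) z -> KL_property (LCD C D) z) ->
   forall x y : nat -> 'rV[R]_n,
     D (y 0%N) -> alternating_projection C D lam mu x y ->
     enorm (row_mx (x k) (y k)) @[k --> \oo] --> +oo \/
     exists2 z : 'rV[R]_(n + n), critical_point (LCD C D) z &
       row_mx (x k) (y k) @[k --> \oo] --> z)
  /\
  (forall xs ys : 'rV[R]_n, C xs -> D ys ->
   KL_property (LCD C D) (row_mx xs ys) ->
   is_min [set enorm (u - v) | u in C & v in D] (enorm (xs - ys)) ->
   exists2 eps : R, 0 < eps &
   forall x y : nat -> 'rV[R]_n,
     D (y 0%N) -> alternating_projection C D lam mu x y ->
     enorm (row_mx (x 0%N) (y 0%N) - row_mx xs ys) < eps ->
     exists xoo yoo : 'rV[R]_n,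
       row_mx (x k) (y k) @[k --> \oo] --> row_mx xoo yoo /\
       is_min [set enorm (u - v) | u in C & v in D] (enorm (xoo - yoo))).
Proof.
split; first exact: alternating_projection_cvg rm0 rmp hlam hmu.
exact: alternating_projection_local_cvg rm0 rmp hlam hmu.
Qed.
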